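(* Let $c_1,\ldots,c_5\in\mathbb{R}$ with $c_4\neq0$, and let $B_1$, $E$ and $G$ be as defined in the context. Then for sufficiently small $t>0$, $$P_E\circ P_{\mathbb{S}^3_+}(G(t))=G\left(t-\frac{t^7}{4c_4^4\|B_1\|^2}\right)+O(t^8).$$
   Context: $\mathbb{S}^3$ is the space of real symmetric $3\times3$ matrices with inner product $\langle A,B\rangle=\operatorname{tr}(A^TB)$ and Frobenius norm $\|\cdot\|$; $\mathbb{S}^3_+$ is the cone of positive semidefinite matrices; $P_C$ denotes the nearest-point projection onto a closed convex set $C$. $O(t^m)$ is as $t\to0$, entrywise for matrices. Let $c_1,\ldots,c_5\in\mathbb{R}$, $c_4\ne0$, $U_*=\begin{pmatrix}1&0&0\\0&0&0\\0&0&0\end{pmatrix}$ and $$B_1=\begin{pmatrix}-2c_1&1&0\\1&0&0\\0&0&0\end{pmatrix},\quad B_2=\begin{pmatrix}2c_2&0&-1\\0&2c_4&0\\-1&0&0\end{pmatrix},\quad B_3=\begin{pmatrix}-2c_3&0&0\\0&-2c_5&1\\0&1&0\end{pmatrix},$$ $$E=\{U_*+p_1B_1+p_2B_2+p_3B_3:p\in\mathbb{R}^3\}.$$ Define the following rational functions of $t$ (near $t=0$): $$w=1-2c_1t+\frac{c_2t^2}{c_4\Big(1-2c_1t+\frac{c_2t^2}{c_4(1-2c_1t)+c_5t}+\frac{c_3t^3}{c_4}\Big)+c_5t}+\frac{c_3t^3}{\Big(c_4\big(1-2c_1t+\frac{c_2t^2}{c_4}\big)+c_5t\Big)\big(1-2c_1t+\frac{c_2t^2}{c_4}\big)},$$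 $$\tilde g_{13}=\frac{t^2}{2c_4w+2c_5t}-\frac{2(2c_5^2+1)t^6}{(2c_4w+2c_5t)^5},\qquad r_0=\frac{c_4\langle B_3,B_1\rangle+c_5\langle B_2,B_1\rangle}{8c_4^5\|B_1\|^2}+\frac1{8c_4^3},$$ $$r_{13}=\frac{c_5}{c_4}r_0t^7+\frac{\langle B_2,B_1\rangle}{16c_4^6\|B_1\|^2}t^7,\qquad r_{23}=-\frac{2c_5t^6}{(2c_4w+2c_5t)^4w}+r_0t^7,$$ $$g_{13}=\tilde g_{13}+r_{13},\qquad g_{23}=-\frac{\tilde g_{13}}{w}t+r_{23},$$ $$G(t)=U_*+tB_1+g_{13}B_2+g_{23}B_3.$$ *)

(* Defs.v *)
From mathcomp Require Import all_boot all_order all_algebra.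
From mathcomp Require Import all_classical all_reals all_analysis.

Set Implicit Arguments.
Unset Strict Implicit.
Unset Printing Implicit Defensive.

Import Order.TTheory GRing.Theory Num.Theory.
Import numFieldNormedType.Exports.

Local Open Scope classical_set_scope.
Local Open Scope ring_scope.

(* MathComp-Analysis norms 'M[R]_n by the maximum of the entries; the
   nearest-point projections below use the Frobenius norm instead. *)
Definition inner_prod (R : realType) (n : nat) (A B : 'M[R]_n) : R :=
  \tr (A^T *m B).

Definition frob_norm (R : realType) (n : nat) (A : 'M[R]_n) : R :=
  Num.sqrt (inner_prod A A).

Definition psd_cone (R : realType) (n : nat) : set 'M[R]_n :=
  [set A | A^T = A /\ forall x : 'cV[R]_n, 0 <= (x^T *m A *m x) 0 0].
Arguments psd_cone : clear implicits.

Definition nearest_point (R : realType) (n : nat)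
    (C : set 'M[R]_n) (X Y : 'M[R]_n) : Prop :=
  C Y /\ forall Z, C Z -> frob_norm (X - Y) <= frob_norm (X - Z).

(* The nearest point of C to X, which exists and is unique when C is closed,
   convex and nonempty; 0 is a junk value for sets without a nearest point. *)
Definition proj_on (R : realType) (n : nat) (C : set 'M[R]_n) (X : 'M[R]_n)
    : 'M[R]_n :=
  xget 0 [set Y | nearest_point C X Y].

Definition mx3 (R : realType) (rows : seq (seq R)) : 'M[R]_3 :=
  \matrix_(i < 3, j < 3) nth 0 (nth [::] rows i) j.

Definition Ustar (R : realType) : 'M[R]_3 :=
  mx3 [:: [:: 1; 0; 0];
          [:: 0; 0; 0];
          [:: 0; 0; 0]].

Definition B1 (R : realType) (c1 : R) : 'M[R]_3 :=
  mx3 [:: [:: - (2 * c1); 1; 0];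
          [:: 1;          0; 0];
          [:: 0;          0; 0]].

Definition B2 (R : realType) (c2 c4 : R) : 'M[R]_3 :=
  mx3 [:: [:: 2 * c2; 0;      -1];
          [:: 0;      2 * c4; 0];
          [:: -1;     0;      0]].

Definition B3 (R : realType) (c3 c5 : R) : 'M[R]_3 :=
  mx3 [:: [:: - (2 * c3); 0;          0];
          [:: 0;          - (2 * c5); 1];
          [:: 0;          1;          0]].

Definition E (R : realType) (c1 c2 c3 c4 c5 : R) : set 'M[R]_3 :=
  [set X | exists p1 p2 p3 : R,
    X = Ustar R + p1 *: B1 c1 + p2 *: B2 c2 c4 + p3 *: B3 c3 c5].

(* The quotients in w, g13t, r0, r13, r23 and g23 have nonzero denominators for
   t near 0 when c4 != 0, so the convention 0^-1 = 0 plays no role there. *)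
Definition w (R : realType) (c1 c2 c3 c4 c5 t : R) : R :=
  1 - 2 * c1 * t
  + c2 * t ^+ 2
    / (c4 * (1 - 2 * c1 * t
             + c2 * t ^+ 2 / (c4 * (1 - 2 * c1 * t) + c5 * t)
             + c3 * t ^+ 3 / c4)
       + c5 * t)
  + c3 * t ^+ 3
    / ((c4 * (1 - 2 * c1 * t + c2 * t ^+ 2 / c4) + c5 * t)
       * (1 - 2 * c1 * t + c2 * t ^+ 2 / c4)).

Definition g13t (R : realType) (c1 c2 c3 c4 c5 t : R) : R :=
  let q := 2 * c4 * w c1 c2 c3 c4 c5 t + 2 * c5 * t in
  t ^+ 2 / q - 2 * (2 * c5 ^+ 2 + 1) * t ^+ 6 / q ^+ 5.

Definition r0 (R : realType) (c1 c2 c3 c4 c5 : R) : R :=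
  (c4 * inner_prod (B3 c3 c5) (B1 c1) + c5 * inner_prod (B2 c2 c4) (B1 c1))
    / (8 * c4 ^+ 5 * frob_norm (B1 c1) ^+ 2)
  + 1 / (8 * c4 ^+ 3).

Definition r13 (R : realType) (c1 c2 c3 c4 c5 t : R) : R :=
  c5 / c4 * r0 c1 c2 c3 c4 c5 * t ^+ 7
  + inner_prod (B2 c2 c4) (B1 c1)
    / (16 * c4 ^+ 6 * frob_norm (B1 c1) ^+ 2) * t ^+ 7.

Definition r23 (R : realType) (c1 c2 c3 c4 c5 t : R) : R :=
  let wt := w c1 c2 c3 c4 c5 t in
  - (2 * c5 * t ^+ 6 / ((2 * c4 * wt + 2 * c5 * t) ^+ 4 * wt))
  + r0 c1 c2 c3 c4 c5 * t ^+ 7.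

Definition g13 (R : realType) (c1 c2 c3 c4 c5 t : R) : R :=
  g13t c1 c2 c3 c4 c5 t + r13 c1 c2 c3 c4 c5 t.

Definition g23 (R : realType) (c1 c2 c3 c4 c5 t : R) : R :=
  - (g13t c1 c2 c3 c4 c5 t / w c1 c2 c3 c4 c5 t * t) + r23 c1 c2 c3 c4 c5 t.

Definition G (R : realType) (c1 c2 c3 c4 c5 t : R) : 'M[R]_3 :=
  Ustar R + t *: B1 c1 + g13 c1 c2 c3 c4 c5 t *: B2 c2 c4
  + g23 c1 c2 c3 c4 c5 t *: B3 c3 c5.

(* Main.v *)
Require Import Defs.
From mathcomp Require Import all_boot all_order all_algebra.
From mathcomp Require Import all_classical all_reals all_analysis.
From mathcomp Require Import ring lra.
Import Order.TTheory GRing.Theory Num.Theory.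
Import numFieldNormedType.Exports.
Local Open Scope classical_set_scope.
Local Open Scope ring_scope.

(* The matrix G(t) is, up to O(t^8), of the form P - N with P = p p^T / G_11 of
   rank one and N a positive semidefinite matrix supported on the orthogonal
   complement of p.  By Moreau's decomposition P is then the projection of
   P - N on the psd cone, and nonexpansiveness gives P_psd(G) = P + O(t^8)
   = G + N + O(t^8).  The functions w, g13 and g23 are such that
   <N, B_k> = - kappa t^7 <B_1, B_k> + O(t^8) with
   kappa = 1 / (4 c4^4 |B_1|^2), so projecting on E gives
   G(t) - kappa t^7 B_1 + O(t^8), which is G(t - kappa t^7) + O(t^8). *)

(** The obstacle is that N is only of order t^4, since its entry N_33 is about t^4 / (4 c4^2), while
    the claim allows an error O(t^8). No [B_k] has an entry in position (3,3), so N_33 is invisible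
    to E except through N_13; the remaining entries of N have order at least 6 and must be known up
    to O(t^8). Taylor expansions in five parameters are avoided: [w] and q = 2 c4 w + 2 c5 t stay
    unexpanded, and the estimates rest on exact rational identities whose terms show their order
    factor by factor. These identities are short because [w] solves the equation for the entry G_11
    up to O(t^6). The constants of the statement are then forced. The factor 2 (2 c5^2 + 1) leaves 2
    t^6 / (q^4 w) as the main term of N_22; pairing with [B1] turns its leading coefficient 1 / (8
    c4^4) into kappa; pairing with [B2] and [B3] fixes the t^7 terms of [g13] and [g23]. *)

(** * Frobenius inner product, variational inequality and existence of nearest points *)

Section FrobeniusProduct.
Context {R : realType} {n : nat}.
Implicit Types (A B D X Y Z : 'M[R]_n) (C : set 'M[R]_n).

Lemma inner_prodE A B : inner_prod A B = \sum_i \sum_j A i j * B i j.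
Proof.
rewrite /inner_prod /mxtrace exchange_big; apply: eq_bigr => i _.
by rewrite mxE; apply: eq_bigr => j _; rewrite mxE.
Qed.

Lemma inner_prodC A B : inner_prod A B = inner_prod B A.
Proof.
by rewrite !inner_prodE; do 2![apply: eq_bigr => ? _]; rewrite mulrC.
Qed.

Lemma inner_prodDl A B D : inner_prod (A + B) D = inner_prod A D + inner_prod B D.
Proof. by rewrite /inner_prod linearD mulmxDl linearD. Qed.

Lemma inner_prodZl (a : R) A B : inner_prod (a *: A) B = a * inner_prod A B.
Proof. by rewrite /inner_prod linearZ /= -scalemxAl mxtraceZ. Qed.

Lemma inner_prodNl A B : inner_prod (- A) B = - inner_prod A B.
Proof. by rewrite -scaleN1r inner_prodZl mulN1r. Qed.

Lemma inner_prodDr A B D : inner_prod A (B + D) = inner_prod A B + inner_prod A D.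
Proof. by rewrite !(inner_prodC A) inner_prodDl. Qed.

Lemma inner_prodZr (a : R) A B : inner_prod A (a *: B) = a * inner_prod A B.
Proof. by rewrite !(inner_prodC A) inner_prodZl. Qed.

Lemma inner_prodNr A B : inner_prod A (- B) = - inner_prod A B.
Proof. by rewrite !(inner_prodC A) inner_prodNl. Qed.

Definition inner_prodL := (inner_prodDl, inner_prodDr, inner_prodNl, inner_prodNr,
  inner_prodZl, inner_prodZr).

Lemma inner_prod_sub_sqr A B :
  inner_prod (A - B) (A - B) = inner_prod A A - 2 * inner_prod A B + inner_prod B B.
Proof. by rewrite !inner_prodL (inner_prodC B A); ring. Qed.

Lemma sqr_entry_le A i j : A i j ^+ 2 <= inner_prod A A.
Proof.
rewrite inner_prodE (bigD1 i) //= (bigD1 j) //= -expr2 -addrA lerDl.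
apply: addr_ge0; last (apply: sumr_ge0 => k _); apply: sumr_ge0 => l _;
  by rewrite -expr2 sqr_ge0.
Qed.

Lemma inner_prod_ge0 A : 0 <= inner_prod A A.
Proof.
by rewrite inner_prodE; do 2![apply: sumr_ge0 => ? _]; rewrite -expr2 sqr_ge0.
Qed.

Lemma frob_norm_sqr A : frob_norm A ^+ 2 = inner_prod A A.
Proof. by rewrite sqr_sqrtr ?inner_prod_ge0. Qed.

Lemma frob_norm_le A B :
  (frob_norm A <= frob_norm B) = (inner_prod A A <= inner_prod B B).
Proof. by rewrite ler_sqrt ?inner_prod_ge0. Qed.

Lemma nearest_point_variational C X Y Z : nearest_point C X Y ->
    (forall s, 0 <= s <= 1 -> C (Y + s *: (Z - Y))) ->
  inner_prod (X - Y) (Z - Y) <= 0.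
Proof.
move=> [_ minY] CYZ; rewrite leNgt; apply/negP.
set D := Z - Y; set a := inner_prod _ D => a0.
have b0 := inner_prod_ge0 D; set b := inner_prod D D in b0.
have ab0 : 0 < a + b by lra.
(* For s = a / (a + b) one has s b = a - s a, so the change -2 s a + s^2 b of the squared distance
   equals -s a - s^2 a < 0. Unlike the minimiser a / b, this s lies in [0, 1] without a case
   distinction. *)
have s01 : 0 <= a / (a + b) <= 1.
  by apply/andP; split; [rewrite divr_ge0 // ltW | rewrite ler_pdivrMr // mul1r lerDl].
have := minY _ (CYZ _ s01); set s := a / _.
rewrite frob_norm_le opprD addrA (inner_prod_sub_sqr _ (s *: D)) !inner_prodZr inner_prodZl -/a -/b.
have sab : s * (a + b) = a by rewrite /s divfK // gt_eqF.
have s0 : 0 < s by rewrite /s divr_gt0.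
nra.
Qed.

Lemma proj_on_nearest C X : (exists Y, nearest_point C X Y) ->
  nearest_point C X (proj_on C X).
Proof. by move=> [Y cY]; apply: (@xgetPex _ 0 [set Y | nearest_point C X Y]); exists Y. Qed.

(** Carries the compactness argument for nearest points, which runs over row vectors, back to
    matrices. *)
Lemma vec_mx_continuous : continuous (@vec_mx R n n).
Proof.
move=> v A [P nP sPA]; rewrite nbhs_filterE /=.
have : nbhs v [set u : 'rV[R]_(n * n) | forall i j, P i j (u 0 (mxvec_index i j))].
  apply: (@filter_forall _ _
    (fun i (u : 'rV[R]_(n * n)) => forall j, P i j (u 0 (mxvec_index i j))) (nbhs v) _) => i.
  apply: (@filter_forall _ _
    (fun j (u : 'rV[R]_(n * n)) => P i j (u 0 (mxvec_index i j))) (nbhs v) _) => j.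
  apply: (@coord_continuous R 1 (n * n) 0 (mxvec_index i j)).
  by have := nP i j; rewrite mxE.
by apply: filterS => u Pu; apply: sPA => i j; rewrite mxE.
Qed.

Lemma entry_continuous i j : continuous (fun A : 'M[R]_n => A i j).
Proof. exact: coord_continuous. Qed.

Lemma inner_prod_self_continuous X :
  continuous (fun Y => inner_prod (X - Y) (X - Y) : R).
Proof.
have -> : (fun Y => inner_prod (X - Y) (X - Y) : R) =
    (fun Y => \sum_i \sum_j (X i j - Y i j) * (X i j - Y i j)).
  apply/funext => Y; rewrite inner_prodE.
  by do 2![apply: eq_bigr => ? _]; rewrite !mxE.
move=> Y; have FY := nbhs_filter Y.
apply: cvg_big => [|i _]; first exact: add_continuous.
apply: cvg_big => [|j _]; first exact: add_continuous.
by apply: cvgM; (apply: cvgB; [exact: cvg_cst | exact: entry_continuous]).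
Qed.

(** The points of [C] no farther from [X] than a fixed [Z] form a closed bounded set, on which the
    squared distance attains its minimum; every other point of [C] is farther than [Z]. *)
Lemma nearest_point_exists C X : closed C -> C !=set0 -> exists Y, nearest_point C X Y.
Proof.
move=> Ccl [Z CZ].
pose f (Y : 'M[R]_n) := inner_prod (X - Y) (X - Y).
pose K : set 'rV[R]_(n * n) := [set v | (C `&` [set Y | f Y <= f Z]) (vec_mx v)].
have fcont : continuous (f \o vec_mx).
  move=> v; apply: continuous_comp; first exact: vec_mx_continuous.
  exact: inner_prod_self_continuous.
have Kcl : closed K.
  apply: (@preimage_closed _ _ vec_mx (C `&` [set Y | f Y <= f Z])).
    by move=> v _; exact: vec_mx_continuous.
  apply: closedI => //.
  apply: (@preimage_closed _ _ f [set r | r <= f Z]); last exact: closed_le.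
  by move=> Y _; exact: inner_prod_self_continuous.
have Kb : bounded_set K.
  (* By 2|u| <= 1 + u^2, applied to an entry x of [X] and to x - y, the entry y of a competitor
     satisfies |y| <= 1 + (f Z + <X, X>) / 2. *)
  exists (2 + f Z + inner_prod X X); split; first exact: num_real.
  move=> M; have f0 : 0 <= f Z := inner_prod_ge0 (X - Z).
  have X0 := inner_prod_ge0 X => ltM v [_ /= fv].
  rewrite [leLHS]mx_normrE; apply/bigmax_leP; split; first lra.
  move=> [i k] _ /=; rewrite ord1; case/mxvec_indexP: k => a b.
  have := sqr_entry_le X a b; have := le_trans (sqr_entry_le (X - vec_mx v) a b) fv.
  rewrite !mxE; set x := X a b; set y := v _ _ => h1 h2.
  have := sqr_ge0 (x - 1); have := sqr_ge0 (x + 1).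
  have := sqr_ge0 (x - y - 1); have := sqr_ge0 (x - y + 1).
  by move=> *; rewrite ler_norml; apply/andP; split; nra.
have KZ : K (mxvec Z) by rewrite /K /= mxvecK.
have [v /= Kv vmin] : exists2 c, c \in K & forall t, t \in K -> (f \o vec_mx) c <= (f \o vec_mx) t.
  apply: compact_EVT_min; [by exists (mxvec Z) | exact: bounded_closed_compact|].
  exact: continuous_subspaceT.
rewrite inE in Kv.
exists (vec_mx v); split; first by case: Kv.
move=> Y CY; rewrite frob_norm_le.
have [YZ|YZ] := leP (f Y) (f Z).
  by have := vmin (mxvec Y); rewrite mxvecK; apply; rewrite inE /K /= mxvecK.
by case: Kv => _ /= h; apply: le_trans h (ltW YZ).
Qed.

End FrobeniusProduct.

(** * Convexity, the positive semidefinite cone and stability of its projection *)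

Section ProjectionStability.
Context {R : realType} {n : nat}.
Implicit Types (A B D X Y Z P N : 'M[R]_n) (C : set 'M[R]_n) (u v p : 'cV[R]_n).

Definition segment_closed C := forall Y Z, C Y -> C Z ->
  forall s : R, 0 <= s <= 1 -> C (Y + s *: (Z - Y)).

(** The variational inequality with <Y - Z, Y - Z> added. For the cone it yields nonexpansiveness;
    for E it shows that [X - Z] matters only through its pairing with a direction of E. *)
Lemma nearest_point_dist C X Y Z : segment_closed C -> nearest_point C X Y -> C Z ->
  inner_prod (Y - Z) (Y - Z) <= inner_prod (X - Z) (Y - Z).
Proof.
move=> Cc nXY CZ; have [CY _] := nXY.
have := nearest_point_variational C X Y Z nXY (Cc _ _ CY CZ).
have -> : X - Z = (X - Y) + (Y - Z) by rewrite addrA subrK.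
rewrite (inner_prodDl (X - Y)) -(opprB Y Z) inner_prodNr; lra.
Qed.

Lemma inner_prod_le_sqr A B : inner_prod A A <= inner_prod B A ->
  inner_prod A A <= inner_prod B B.
Proof. by have := inner_prod_ge0 (B - A); rewrite inner_prod_sub_sqr; lra. Qed.

Lemma inner_prod_rank1l u v A : inner_prod (u *m v^T) A = (u^T *m A *m v) 0 0.
Proof.
rewrite /inner_prod trmx_mul trmxK -(mulmxA v) mxtrace_mulC.
by rewrite [LHS]big_ord1.
Qed.

Lemma inner_prod_rank1 u v p q :
  inner_prod (u *m v^T) (p *m q^T) = (u^T *m p) 0 0 * (q^T *m v) 0 0.
Proof.
by rewrite inner_prod_rank1l mulmxA -mulmxA [in LHS]mxE big_ord1.
Qed.

(** Writing the quadratic form as a pairing with u u^T makes the cone an intersection of sets cut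
    out by linear functionals, from which convexity and closedness are immediate. *)
Lemma psd_coneP A : psd_cone R n A <->
  (forall i j, A i j = A j i) /\ forall u, 0 <= inner_prod (u *m u^T) A.
Proof.
split=> [[sA pA]|[sA pA]]; split.
- by move=> i j; rewrite -[in LHS]sA mxE.
- by move=> u; rewrite inner_prod_rank1l.
- by apply/matrixP => i j; rewrite mxE.
- by move=> u; rewrite -inner_prod_rank1l.
Qed.

Lemma psd_cone_rank1 (a : R) p : 0 <= a -> psd_cone R n (a *: (p *m p^T)).
Proof.
move=> a0; apply/psd_coneP; split.
  by move=> i j; rewrite !mxE !big_ord1 !mxE (mulrC (p i 0)).
move=> u; rewrite inner_prodZr inner_prod_rank1 mulr_ge0 //.
suff -> : (p^T *m u) 0 0 = (u^T *m p) 0 0 by rewrite -expr2 sqr_ge0.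
by rewrite !mxE; apply: eq_bigr => i _; rewrite !mxE mulrC.
Qed.

Lemma psd_cone_segment : segment_closed (psd_cone R n).
Proof.
move=> Y Z /psd_coneP [sY pY] /psd_coneP [sZ pZ] s s01; apply/psd_coneP; split.
  by move=> i j; rewrite !mxE sY sZ.
by move=> u; rewrite !inner_prodL; have := pY u; have := pZ u; nra.
Qed.

Lemma inner_prod_continuous B : continuous (fun A => inner_prod B A : R).
Proof.
have -> : (fun A => inner_prod B A : R) = (fun A => \sum_i \sum_j B i j * A i j).
  by apply/funext => A; rewrite inner_prodE.
move=> Y; have FY := nbhs_filter Y.
apply: cvg_big => [|i _]; first exact: add_continuous.
apply: cvg_big => [|j _]; first exact: add_continuous.
by apply: cvgM; [exact: cvg_cst | exact: entry_continuous].
Qed.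

Lemma psd_cone_closed : closed (psd_cone R n).
Proof.
have -> : psd_cone R n =
    (\bigcap_(ij in [set: 'I_n * 'I_n]) [set A : 'M[R]_n | A ij.1 ij.2 - A ij.2 ij.1 = 0])
    `&` (\bigcap_(u in [set: 'cV[R]_n]) [set A | 0 <= inner_prod (u *m u^T) A]).
  apply/seteqP; split=> A.
    move=> /psd_coneP [sA pA]; split=> [[i j] _ /=|u _]; last exact: pA.
    by rewrite sA subrr.
  move=> [sA pA]; apply/psd_coneP; split=> [i j|u]; last exact: (pA u I).
  by apply/eqP; rewrite -subr_eq0; apply/eqP/(sA (i, j) I).
apply: closedI.
  apply: closed_bigI => -[i j] _ /=.
  apply: (@preimage_closed _ _ (fun A : 'M[R]_n => A i j - A j i) [set x | x = 0]).
    by move=> Y _; apply: continuousB; exact: entry_continuous.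
  exact: closed_eq.
apply: closed_bigI => u _ /=.
apply: (@preimage_closed _ _ (fun A => inner_prod (u *m u^T) A) [set x | 0 <= x]).
  by move=> Y _; exact: inner_prod_continuous.
exact: closed_ge.
Qed.

Lemma psd_proj_nearest X : nearest_point (psd_cone R n) X (proj_on (psd_cone R n) X).
Proof.
apply: proj_on_nearest; apply: nearest_point_exists; first exact: psd_cone_closed.
by exists (0 *: ((0 : 'cV[R]_n) *m 0^T)); exact: psd_cone_rank1.
Qed.

(* Moreau: such P and N make P the projection of P - N, and projections are
   nonexpansive. *)
Lemma psd_proj_stable X P N : psd_cone R n P -> inner_prod N P = 0 ->
    (forall Z, psd_cone R n Z -> 0 <= inner_prod N Z) ->
  let D := proj_on (psd_cone R n) X - P in
  inner_prod D D <= inner_prod (X - (P - N)) (X - (P - N)).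
Proof.
move=> pP NP0 N0 /=; set Y := proj_on _ _.
have nY : nearest_point (psd_cone R n) X Y := psd_proj_nearest X.
apply: inner_prod_le_sqr; apply: le_trans (nearest_point_dist _ _ _ _ psd_cone_segment nY pP) _.
(* Replacing X - P by X - (P - N) adds <N, Y - P> = <N, Y>, which is nonnegative. *)
have -> : X - (P - N) = (X - P) + N by rewrite opprB addrCA addrC.
rewrite (inner_prodDl (X - P)) lerDl inner_prodDr inner_prodNr NP0 subr0.
by apply: N0; case: nY.
Qed.

Definition quad_comb u v (a b d : R) : 'M[R]_n :=
  a *: (u *m u^T) + b *: (u *m v^T + v *m u^T) + d *: (v *m v^T).

(** Completing the square: d times the combination is (d v + b u)(d v + b u)^T + (a d - b^2) u
    u^T. *)
Lemma quad_comb_dual u v a b d Z : 0 < d -> b ^+ 2 <= a * d -> psd_cone R n Z ->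
  0 <= inner_prod (quad_comb u v a b d) Z.
Proof.
move=> d0 bad /psd_coneP [sZ pZ]; rewrite -(pmulr_rge0 _ d0).
have := pZ (d *: v + b *: u); have := pZ u.
rewrite linearD /= !linearZ /= mulmxDl !mulmxDr -!scalemxAr -!scalemxAl !inner_prodL.
have -> : inner_prod (v *m u^T) Z = inner_prod (u *m v^T) Z.
  rewrite !inner_prodE exchange_big; do 2![apply: eq_bigr => ? _].
  by rewrite sZ !mxE !big_ord1 !mxE (mulrC (v _ _)).
nra.
Qed.

Lemma quad_comb_orth u v a b d p : (p^T *m u) 0 0 = 0 -> (p^T *m v) 0 0 = 0 ->
  inner_prod (quad_comb u v a b d) (p *m p^T) = 0.
Proof.
by move=> pu pv; rewrite !inner_prodL !inner_prod_rank1 pu pv !(mulr0, addr0).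
Qed.

End ProjectionStability.

(** * Orders at 0 from the right, and functions Lipschitz near 0 *)

Section OneSidedOrder.
Context {R : realType}.
Implicit Types (f g h : R -> R) (m n : nat).

(** The exponent is an explicit argument, so that the order of a compound expression can be computed
    from the orders of its parts. No sign is imposed on [K]. *)
Definition orderO n f :=
  exists K : R, \forall t \near (0 : R)^'+, `|f t| <= K * t ^+ n.

Lemma orderO_near n f g : (\forall t \near (0 : R)^'+, f t = g t) ->
  orderO n g -> orderO n f.
Proof.
by move=> fg [K gK]; exists K; apply: filterS2 fg gK => t ->.
Qed.

Lemma near_gt0 : \forall t \near (0 : R)^'+, 0 < t.
Proof. exact: nbhs_right_gt. Qed.

Lemma orderO_le m n f : (n <= m)%N -> orderO m f -> orderO n f.
Proof.
move=> nm [K fK]; exists (Num.max K 0).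
apply: filterS3 near_gt0 (nbhs_right_lt (@ltr01 R)) fK => t t0 t1 /le_trans; apply.
apply: (@le_trans _ _ (Num.max K 0 * t ^+ m)).
  by rewrite ler_wpM2r ?le_max ?lexx // exprn_ge0 // ltW.
by rewrite ler_wpM2l ?le_max ?lexx ?orbT // ler_wiXn2l // ltW.
Qed.

Lemma orderO_add m n f g : orderO m f -> orderO n g ->
  orderO (minn m n) (fun t => f t + g t).
Proof.
move=> fm gn; have [K fK] := orderO_le _ _ _ (geq_minl m n) fm.
have [L gL] := orderO_le _ _ _ (geq_minr m n) gn.
exists (K + L); apply: filterS2 fK gL => t fK gL.
by rewrite mulrDl (le_trans (ler_normD _ _)) // lerD.
Qed.

Lemma orderO_opp n f : orderO n f -> orderO n (fun t => - f t).
Proof. by move=> [K fK]; exists K; apply: filterS fK => t; rewrite normrN. Qed.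

Lemma orderO_mul m n f g : orderO m f -> orderO n g ->
  orderO (m + n) (fun t => f t * g t).
Proof.
move=> [K fK] [L gL]; exists (K * L); apply: filterS2 fK gL => t fK gL.
by rewrite normrM exprD mulrACA ler_pM.
Qed.

Lemma orderO_cst (a : R) : orderO 0 (fun=> a).
Proof. by exists `|a|; apply: nearW => t; rewrite expr0 mulr1. Qed.

Lemma orderO_id : orderO 1 (fun t : R => t).
Proof.
by exists 1; apply: filterS near_gt0 => t t0; rewrite mul1r expr1 gtr0_norm.
Qed.

Lemma orderO_exp m n f : orderO m f -> orderO (m * n) (fun t => f t ^+ n).
Proof.
move=> fm; elim: n => [|n IHn]; first by rewrite muln0; exact: orderO_cst.
under eq_fun do rewrite exprS.
by rewrite mulnS; exact: orderO_mul.
Qed.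

Lemma orderO_near_ge (a : R) n f : 0 < a -> orderO n.+1 (fun t => f t - a * t ^+ n) ->
  \forall t \near (0 : R)^'+, 0 < f t.
Proof.
move=> a0 [K fK]; have K1 : 0 < `|K| + 1 by rewrite ltr_wpDl.
have e0 : 0 < a / (`|K| + 1) by rewrite divr_gt0.
apply: filterS3 near_gt0 (nbhs_right_lt e0) fK => t t0.
rewrite ltr_pdivlMr // ler_norml exprS mulrA => ta /andP[fK _].
have tn : 0 < t ^+ n by rewrite exprn_gt0.
have Kt : K * t <= `|K| * t by rewrite ler_pM2r // ler_norm.
have : (a - `|K| * t) * t ^+ n > 0 by rewrite mulr_gt0 //; lra.
have : K * t * t ^+ n <= `|K| * t * t ^+ n by rewrite ler_pM2r.
move: fK; lra.
Qed.

(** A substitute for differentiability that is stable under sums, products and inverses, and that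
    yields boundedness, f t = f 0 + O(t) and control of shifted arguments. The two-sided
    neighbourhood admits an argument t - h t of any sign. *)
Definition lip0 f := exists K e : R, 0 < e /\
  forall x y, `|x| < e -> `|y| < e -> `|f x - f y| <= K * `|x - y|.

Lemma lip0_cst (a : R) : lip0 (fun=> a).
Proof. by exists 0, 1; split=> // x y _ _; rewrite subrr normr0 mul0r. Qed.

Lemma lip0_id : lip0 (fun x => x).
Proof. by exists 1, 1; split=> // x y _ _; rewrite mul1r. Qed.

Lemma lip0_add f g : lip0 f -> lip0 g -> lip0 (fun x => f x + g x).
Proof.
move=> [K [e [e0 fK]]] [L [d [d0 gL]]]; exists (K + L), (Num.min e d).
split=> [|x y]; first by rewrite lt_min e0.
rewrite !lt_min => /andP[xe xd] /andP[ye yd].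
rewrite opprD addrACA mulrDl (le_trans (ler_normD _ _)) //.
by rewrite lerD ?fK ?gL.
Qed.

Lemma lip0_opp f : lip0 f -> lip0 (fun x => - f x).
Proof.
move=> [K [e [e0 fK]]]; exists K, e; split=> // x y xe ye.
by rewrite -opprD normrN fK.
Qed.

Lemma lip0_bounded f : lip0 f ->
  exists M e : R, [/\ 0 < e, 0 <= M & forall x, `|x| < e -> `|f x| <= M].
Proof.
move=> [K [e [e0 fK]]]; exists (`|f 0| + `|K| * e), e; split=> //.
  by rewrite addr_ge0 // mulr_ge0 // ltW.
move=> x xe; rewrite -{1}(subrK (f 0) (f x)) (le_trans (ler_normD _ _)) //.
rewrite addrC lerD2l (le_trans (fK x 0 xe _)) ?normr0 // subr0.
by rewrite (le_trans (ler_wpM2r _ (ler_norm K))) // ler_wpM2l // ltW.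
Qed.

Lemma lip0_mul f g : lip0 f -> lip0 g -> lip0 (fun x => f x * g x).
Proof.
move=> lf lg; have [M [a [a0 M0 fM]]] := lip0_bounded _ lf.
have [N [b [b0 N0 gN]]] := lip0_bounded _ lg.
move: lf lg => [K [e [e0 fK]]] [L [d [d0 gL]]].
exists (M * L + N * K), (Num.min (Num.min a b) (Num.min e d)).
split=> [|x y]; first by rewrite !lt_min a0 b0 e0.
rewrite !lt_min => /andP[/andP[xa xb] /andP[xe xd]] /andP[/andP[ya yb] /andP[ye yd]].
have -> : f x * g x - f y * g y = f x * (g x - g y) + g y * (f x - f y) by ring.
rewrite mulrDl -!mulrA (le_trans (ler_normD _ _)) // !normrM.
by rewrite lerD // ler_pM ?fM ?gN ?fK ?gL.
Qed.

Lemma lip0_exp f n : lip0 f -> lip0 (fun x => f x ^+ n).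
Proof.
move=> lf; elim: n => [|n IHn]; first exact: lip0_cst.
by under eq_fun do rewrite exprS; exact: lip0_mul.
Qed.

Lemma lip0_inv f : lip0 f -> f 0 != 0 -> lip0 (fun x => (f x)^-1).
Proof.
move=> [K [e [e0 fK]]] f0.
have a0 : 0 < `|f 0| / 2 by rewrite divr_gt0 // normr_gt0.
have K1 : 0 < `|K| + 1 by rewrite ltr_wpDl.
(* Within [d] the value of [f] moves by less than |f 0| / 2, which bounds the inverse; the + 1 keeps
   the divisor positive when K = 0. *)
pose d := Num.min e (`|f 0| / 2 / (`|K| + 1)).
have fd x : `|x| < d -> `|f 0| / 2 < `|f x|.
  rewrite lt_min => /andP[xe]; rewrite ltr_pdivlMr // => xK.
  have := fK x 0 xe; rewrite normr0 subr0 => /(_ e0) fx.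
  have := ler_normB (f x - f 0) (f x); rewrite addrAC subrr sub0r normrN => h.
  have := ler_wpM2r (normr_ge0 x) (ler_norm K); have := normr_ge0 x.
  lra.
exists (K / (`|f 0| / 2) ^+ 2), d; split.
  by rewrite lt_min e0 divr_gt0.
move=> x y xd yd; have fx := fd _ xd; have fy := fd _ yd.
have fx0 : f x != 0 by rewrite -normr_gt0 (lt_trans a0).
have fy0 : f y != 0 by rewrite -normr_gt0 (lt_trans a0).
have -> : (f x)^-1 - (f y)^-1 = - (f x - f y) * ((f x)^-1 * (f y)^-1).
  by field; rewrite fx0 fy0.
rewrite normrM normrN mulrAC ler_pM // ?fK //.
- by move: xd; rewrite lt_min => /andP[].
- by move: yd; rewrite lt_min => /andP[].
- by rewrite normrM !normfV expr2 invfM ler_pM // ?invr_ge0 // lef_pV2 ?posrE ?ltW // (lt_trans a0).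
Qed.

Lemma near_norm_lt (e : R) : 0 < e -> \forall t \near (0 : R)^'+, `|t| < e.
Proof.
move=> e0; apply: filterS2 near_gt0 (nbhs_right_lt e0) => t t0.
by rewrite gtr0_norm.
Qed.

Lemma lip0_orderO1 f : lip0 f -> orderO 1 (fun t => f t - f 0).
Proof.
move=> [K [e [e0 fK]]]; exists K; apply: filterS2 near_gt0 (near_norm_lt _ e0) => t t0 te.
by have := fK t 0 te; rewrite normr0 subr0 expr1 (gtr0_norm t0); apply.
Qed.

Lemma lip0_orderO0 f : lip0 f -> orderO 0 (fun t => f t).
Proof.
move=> /lip0_bounded [M [e [e0 _ fM]]]; exists M.
by apply: filterS (near_norm_lt _ e0) => t /fM; rewrite expr0 mulr1.
Qed.

Lemma orderO_near_small n f (e : R) : 0 < e -> orderO n.+1 f ->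
  \forall t \near (0 : R)^'+, `|f t| < e.
Proof.
move=> e0 fn; have [K fK] := orderO_le n.+1 1 f isT fn.
have K1 : 0 < `|K| + 1 by rewrite ltr_wpDl.
apply: filterS3 near_gt0 (nbhs_right_lt (divr_gt0 e0 K1)) fK => t t0.
rewrite ltr_pdivlMr // expr1 => te /le_lt_trans; apply.
have := ler_wpM2r (ltW t0) (ler_norm K); lra.
Qed.

Lemma orderO_near_neq0 f : f 0 != 0 -> orderO 1 (fun t => f t - f 0) ->
  \forall t \near (0 : R)^'+, f t != 0.
Proof.
move=> f0 f1; have f0' : 0 < `|f 0| by rewrite normr_gt0.
have := orderO_near_small 0 _ _ f0' f1.
apply: filterS => t; apply: contraTneq => ->.
by rewrite sub0r normrN ltxx.
Qed.

Lemma lip0_near_neq0 f : lip0 f -> f 0 != 0 ->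
  \forall t \near (0 : R)^'+, f t != 0.
Proof. by move=> lf f0; apply: orderO_near_neq0 f0 (lip0_orderO1 _ lf). Qed.

Lemma lip0_orderO1_at f a : lip0 (fun t => f t) -> f 0 = a ->
  orderO 1 (fun t => f t - a).
Proof. by move=> lf <-; exact: lip0_orderO1. Qed.

Lemma lip0_shift f h n : lip0 f -> orderO n.+1 h ->
  orderO n.+1 (fun t => f (t - h t) - f t).
Proof.
move=> [K [e [e0 fK]]] hn; have [L hL] := hn.
have e20 : 0 < e / 2 by rewrite divr_gt0.
exists (`|K| * L).
apply: filterS3 (near_norm_lt _ e20) (orderO_near_small _ _ _ e20 hn) hL => t te he hL.
have tht : `|t - h t| < e by have := ler_normB t (h t); lra.
have {}te : `|t| < e by lra.
apply: le_trans (fK _ _ tht te) _.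
rewrite addrAC subrr sub0r normrN -mulrA.
by rewrite (le_trans (ler_wpM2r _ (ler_norm K))) // ler_wpM2l.
Qed.

End OneSidedOrder.

(* Infers the order of an expression built from [t], constants and functions
   with a hypothesis on their order. *)
Ltac infer_orderO :=
  match goal with
  | H : orderO ?n ?f |- orderO _ ?f => exact: H
  | |- orderO _ (fun t => _ + _) => eapply orderO_add; infer_orderO
  | |- orderO _ (fun t => - _) => eapply orderO_opp; infer_orderO
  | |- orderO _ (fun t => _ * _) => eapply orderO_mul; infer_orderO
  | |- orderO _ (fun t => _ ^+ _) => eapply orderO_exp; infer_orderO
  | |- orderO _ (fun t => t) => exact: orderO_id
  | |- orderO _ (fun t => ?a) => exact: orderO_cst
  | |- orderO ?n ?f =>
    lazymatch f with fun _ => _ => fail | _ => change (orderO n (fun t => f t)) end;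
    infer_orderO
  end.
(** The inferred order is a closed expression in sums, products and minima of numerals, so comparing
    it with the required order is a computation. *)
Ltac solve_orderO := eapply orderO_le; [|infer_orderO]; by [].

Ltac solve_lip0 :=
  match goal with
  | H : lip0 ?f |- lip0 ?f => exact: H
  | |- lip0 (fun t => _ + _) => apply: lip0_add; solve_lip0
  | |- lip0 (fun t => - _) => apply: lip0_opp; solve_lip0
  | |- lip0 (fun t => _ * _) => apply: lip0_mul; solve_lip0
  | |- lip0 (fun t => _ ^+ _) => apply: lip0_exp; solve_lip0
  | |- lip0 (fun t => t) => exact: lip0_id
  | |- lip0 (fun t => ?a) => exact: lip0_cst
  | |- lip0 ?f =>
    lazymatch f with fun _ => _ => fail | _ => change (lip0 (fun t => f t)) end;
    solve_lip0
  end.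

(** * Orders of matrix entries, inner products and shifts *)

Section MatrixOrder.
Context {R : realType}.
Implicit Types (f g : R -> R) (m n : nat).

Lemma orderO_sum n (I : Type) (r : seq I) (F : I -> R -> R) :
  (forall i, orderO n (fun t => F i t)) -> orderO n (fun t => \sum_(i <- r) F i t).
Proof.
move=> OF; elim: r => [|i r IHr].
  under eq_fun do rewrite big_nil.
  by exists 0; apply: nearW => t; rewrite normr0 mul0r.
under eq_fun do rewrite big_cons.
by rewrite -(minnn n); exact: orderO_add.
Qed.

Lemma orderO_inner_prod m n k (A B : R -> 'M[R]_k) :
    (forall i j, orderO m (fun t => A t i j)) -> (forall i j, orderO n (fun t => B t i j)) ->
  orderO (m + n) (fun t => inner_prod (A t) (B t)).
Proof.
move=> OA OB; under eq_fun do rewrite inner_prodE.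
by apply: orderO_sum => i; apply: orderO_sum => j; exact: orderO_mul.
Qed.

Lemma orderO_sqr n f g : (\forall t \near (0 : R)^'+, f t ^+ 2 <= g t) ->
  orderO (n + n) g -> orderO n f.
Proof.
(* Since K <= (|K| + 1)^2, this constant serves in place of a square root of K. *)
move=> fg [K gK]; exists (`|K| + 1).
apply: filterS3 near_gt0 fg gK => t t0 fg gK.
have K0 := normr_ge0 K; have tn : 0 < t ^+ n by rewrite exprn_gt0.
have K1 : 0 <= `|K| + 1 by lra.
rewrite -(@ler_pXn2r _ 2) ?nnegrE ?mulr_ge0 ?(ltW tn) //.
rewrite real_normK ?num_real // (le_trans fg) // (le_trans (ler_norm _)) // (le_trans gK) //.
rewrite exprD exprMn -expr2 ler_pM2r ?exprn_gt0 //.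
have := ler_norm K; nra.
Qed.

(** Passes from Frobenius-norm inequalities, such as nonexpansiveness, to entrywise orders. *)
Lemma orderO_frobenius n k (D W : R -> 'M[R]_k) :
    (\forall t \near (0 : R)^'+, inner_prod (D t) (D t) <= inner_prod (W t) (W t)) ->
    (forall i j, orderO n (fun t => W t i j)) ->
  forall i j, orderO n (fun t => D t i j).
Proof.
move=> DW OW i j; apply: orderO_sqr (orderO_inner_prod _ _ _ _ _ OW OW).
by apply: filterS DW => t; apply: le_trans; exact: sqr_entry_le.
Qed.

(** A Lipschitz bound alone would give order 7; the factor t^2, present in both [g13] and [g23],
    gains the missing power of t. *)
Lemma orderO_shift (k h : R -> R) : lip0 k -> orderO 7 (fun t => h t) ->
  orderO 8 (fun t => (t - h t) ^+ 2 * k (t - h t) - t ^+ 2 * k t).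
Proof.
move=> lk Oh; have Ok := lip0_orderO0 _ lk; have Okk := lip0_shift _ _ _ lk Oh.
apply: (@orderO_near _ _ _ (fun t => (t - h t) ^+ 2 * (k (t - h t) - k t)
  - h t * (2 * t - h t) * k t)); last solve_orderO.
by apply: nearW => t; ring.
Qed.

End MatrixOrder.

(** * The matrices N and the affine space E *)

Section ThreeByThree.
Context {R : realType}.

Definition col3 (a b c : R) : 'cV[R]_3 := \col_i nth 0 [:: a; b; c] i.

(** Both spanning vectors are orthogonal to (1, y, z), and the lower right block is the free
    symmetric block with entries a, b, d. *)
Definition Nmx (y z a b d : R) : 'M[R]_3 := quad_comb (col3 (- y) 1 0) (col3 (- z) 0 1) a b d.

Definition N11 (y z a b d : R) := a * y ^+ 2 + 2 * b * y * z + d * z ^+ 2.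

Lemma NmxE y z a b d : Nmx y z a b d =
  mx3 [:: [:: N11 y z a b d; - (a * y + b * z); - (b * y + d * z)];
          [:: - (a * y + b * z); a; b];
          [:: - (b * y + d * z); b; d]].
Proof.
apply/matrixP => -[[|[|[|//]]] i3] -[[|[|[|//]]] j3];
  by rewrite /N11 !mxE !big_ord_recl !big_ord0 !mxE /=; ring.
Qed.

Lemma inner_Nmx_B1 (c1 y z a b d : R) : inner_prod (Nmx y z a b d) (B1 c1) =
  - (2 * c1) * N11 y z a b d - 2 * (a * y + b * z).
Proof. by rewrite NmxE inner_prodE !big_ord_recl !big_ord0 !mxE /=; ring. Qed.

Lemma inner_Nmx_B2 (c2 c4 y z a b d : R) : inner_prod (Nmx y z a b d) (B2 c2 c4) =
  2 * c2 * N11 y z a b d + 2 * c4 * a + 2 * (b * y + d * z).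
Proof. by rewrite NmxE inner_prodE !big_ord_recl !big_ord0 !mxE /=; ring. Qed.

Lemma inner_Nmx_B3 (c3 c5 y z a b d : R) : inner_prod (Nmx y z a b d) (B3 c3 c5) =
  - (2 * c3) * N11 y z a b d - 2 * c5 * a + 2 * b.
Proof. by rewrite NmxE inner_prodE !big_ord_recl !big_ord0 !mxE /=; ring. Qed.

Lemma Nmx_orth (s y z a b d : R) : inner_prod (Nmx y z a b d)
  (col3 s (s * y) (s * z) *m (col3 s (s * y) (s * z))^T) = 0.
Proof. by apply: quad_comb_orth; rewrite !mxE !big_ord_recl !big_ord0 !mxE /=; ring. Qed.

Lemma segment_closed_E (c1 c2 c3 c4 c5 : R) : segment_closed (E c1 c2 c3 c4 c5).
Proof.
move=> Y Z [p1 [p2 [p3 ->]]] [r1 [r2 [r3 ->]]] s _.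
exists (p1 + s * (r1 - p1)), (p2 + s * (r2 - p2)), (p3 + s * (r3 - p3)).
by apply/matrixP => i j; rewrite !mxE; ring.
Qed.

(** Each [B_k] owns one off-diagonal position, so the parameters can be read off the entries; E thus
    becomes the zero set of continuous functions. *)
Lemma EP (c1 c2 c3 c4 c5 : R) (X : 'M[R]_3) : E c1 c2 c3 c4 c5 X <->
  X = Ustar R + X 0 1 *: B1 c1 + (- X 0 2%:R) *: B2 c2 c4 + X 1 2%:R *: B3 c3 c5.
Proof.
split=> [[p1 [p2 [p3 XE]]]|XE]; last by exists (X 0 1), (- X 0 2%:R), (X 1 2%:R).
have -> : X 0 1 = p1 by rewrite XE !mxE /=; ring.
have -> : X 0 2%:R = - p2 by rewrite XE !mxE /=; ring.
have -> : X 1 2%:R = p3 by rewrite XE !mxE /=; ring.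
by rewrite opprK.
Qed.

Lemma closed_E (c1 c2 c3 c4 c5 : R) : closed (E c1 c2 c3 c4 c5).
Proof.
pose f (ij : 'I_3 * 'I_3) (X : 'M[R]_3) : R := X ij.1 ij.2 - (Ustar R ij.1 ij.2
  + X 0 1 * B1 c1 ij.1 ij.2 - X 0 2%:R * B2 c2 c4 ij.1 ij.2 + X 1 2%:R * B3 c3 c5 ij.1 ij.2).
have -> : E c1 c2 c3 c4 c5 = \bigcap_(ij in [set: 'I_3 * 'I_3]) [set X | f ij X = 0].
  apply/seteqP; split=> X.
    move=> /EP XE [i j] _; rewrite /f /= {1}XE !mxE; ring.
  move=> fX; apply/EP/matrixP => i j; apply/eqP; rewrite -subr_eq0; apply/eqP.
  by rewrite -[RHS](fX (i, j) I) /f !mxE mulNr.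
apply: closed_bigI => ij _; apply: (@preimage_closed _ _ (f ij) [set x | x = 0]).
  2: exact: closed_eq.
move=> X _; have ct i j := @entry_continuous R 3 i j X.
have cc (a : R) : {for X, continuous (fun _ : 'M[R]_3 => a)} by exact: cst_continuous.
have cm i j (a : R) : {for X, continuous (fun Y : 'M[R]_3 => Y i j * a)}.
  exact: (continuousM (ct i j) (cc a)).
apply: continuousB (ct _ _) _; apply: continuousD (cm _ _ _).
by apply: continuousB (cm _ _ _); apply: continuousD (cc _) (cm _ _ _).
Qed.

Lemma E_proj_nearest (c1 c2 c3 c4 c5 : R) (X : 'M[R]_3) :
  nearest_point (E c1 c2 c3 c4 c5) X (proj_on (E c1 c2 c3 c4 c5) X).
Proof.
apply: proj_on_nearest; apply: nearest_point_exists; first exact: closed_E.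
by exists (Ustar R + 0 *: B1 c1 + 0 *: B2 c2 c4 + 0 *: B3 c3 c5), 0, 0, 0.
Qed.

(** The projection is controlled by the three pairings of X - Y with the [B_k], without inverting
    their Gram matrix: the coordinates of D are entries of D, hence bounded by its norm. *)
Lemma E_proj_dist (c1 c2 c3 c4 c5 : R) (X Y : 'M[R]_3) : E c1 c2 c3 c4 c5 Y ->
  let D := proj_on (E c1 c2 c3 c4 c5) X - Y in
  inner_prod D D <= 3 * (inner_prod (X - Y) (B1 c1) ^+ 2
    + inner_prod (X - Y) (B2 c2 c4) ^+ 2 + inner_prod (X - Y) (B3 c3 c5) ^+ 2).
Proof.
move=> EY /=; have nZ := E_proj_nearest c1 c2 c3 c4 c5 X; set Z := proj_on _ _ in nZ *.
have := nearest_point_dist _ _ _ _ (segment_closed_E c1 c2 c3 c4 c5) nZ EY.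
have [EZ _] := nZ; set D := Z - Y; set V := X - Y.
have -> : inner_prod V D = D 0 1 * inner_prod V (B1 c1) - D 0 2%:R * inner_prod V (B2 c2 c4)
    + D 1 2%:R * inner_prod V (B3 c3 c5).
  rewrite -mulNr -!inner_prodZr -!inner_prodDr; congr inner_prod.
  rewrite {1}/D; move/EP: EZ => ->; move/EP: EY => ->.
  by apply/matrixP => i j; rewrite !mxE /=; ring.
have := sqr_entry_le D 0 1; have := sqr_entry_le D 0 2%:R; have := sqr_entry_le D 1 2%:R.
move: (inner_prod V (B1 c1)) (inner_prod V (B2 c2 c4)) (inner_prod V (B3 c3 c5)) => e1 e2 e3.
move: (D 0 1) (D 0 2%:R) (D 1 2%:R) (inner_prod D D) => d1 d2 d3 s.
(* Here 6 s <= sum of (d_k^2 + 9 e_k^2) <= 3 s + 9 * (sum of e_k^2), whence the constant 3. *)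
have := sqr_ge0 (d1 - 3 * e1); have := sqr_ge0 (d2 + 3 * e2); have := sqr_ge0 (d3 - 3 * e3).
nra.
Qed.

End ThreeByThree.

(** * The function [w] as an approximate fixed point *)

Section Expansion.
Context {R : realType} (c1 c2 c3 c4 c5 : R) (hc4 : c4 != 0).
Local Notation W := (w c1 c2 c3 c4 c5).
Local Notation gam := (g13 c1 c2 c3 c4 c5).
Local Notation del := (g23 c1 c2 c3 c4 c5).
Local Notation rr := (r0 c1 c2 c3 c4 c5).
Local Notation b11 := (inner_prod (B1 c1) (B1 c1)).
Local Notation b21 := (inner_prod (B2 c2 c4) (B1 c1)).
Local Notation b31 := (inner_prod (B3 c3 c5) (B1 c1)).

(* The nested denominators and inner approximations in the definition of w. *)
Definition w_d t := c4 * (1 - 2 * c1 * t) + c5 * t.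
Definition w_a t := 1 - 2 * c1 * t + c2 * t ^+ 2 / w_d t + c3 * t ^+ 3 / c4.
Definition w_A t := c4 * w_a t + c5 * t.
Definition w_b t := 1 - 2 * c1 * t + c2 * t ^+ 2 / c4.
Definition w_B t := (c4 * w_b t + c5 * t) * w_b t.
Definition q t := 2 * c4 * W t + 2 * c5 * t.

Lemma wE t : W t = 1 - 2 * c1 * t + c2 * t ^+ 2 / w_A t + c3 * t ^+ 3 / w_B t.
Proof. by []. Qed.

Lemma w_d0 : w_d 0 = c4. Proof. rewrite /w_d; ring. Qed.
Lemma w_a0 : w_a 0 = 1. Proof. rewrite /w_a w_d0; field; exact: hc4. Qed.
Lemma w_A0 : w_A 0 = c4. Proof. rewrite /w_A w_a0; ring. Qed.
Lemma w_b0 : w_b 0 = 1. Proof. rewrite /w_b; field; exact: hc4. Qed.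
Lemma w_B0 : w_B 0 = c4. Proof. rewrite /w_B w_b0; ring. Qed.
Lemma w0 : W 0 = 1. Proof. rewrite wE w_A0 w_B0; field; exact: hc4. Qed.
Lemma q0 : q 0 = 2 * c4. Proof. rewrite /q w0; ring. Qed.
Lemma q0_neq0 : q 0 != 0. Proof. by rewrite q0 mulf_neq0 ?pnatr_eq0. Qed.
Lemma w0_neq0 : W 0 != 0. Proof. by rewrite w0 oner_neq0. Qed.

Lemma lip_wd : lip0 (fun t => w_d t).
Proof. rewrite /w_d; solve_lip0. Qed.
Lemma lip_wdV : lip0 (fun t => (w_d t)^-1).
Proof. by apply: lip0_inv lip_wd _; rewrite w_d0. Qed.
Lemma lip_wa : lip0 (fun t => w_a t).
Proof. have := lip_wdV; rewrite /w_a => lV; solve_lip0. Qed.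
Lemma lip_wAV : lip0 (fun t => (w_A t)^-1).
Proof.
apply: lip0_inv; last by rewrite w_A0.
rewrite /w_A; have := lip_wa => la; solve_lip0.
Qed.
Lemma lip_wb : lip0 (fun t => w_b t).
Proof. rewrite /w_b; solve_lip0. Qed.
Lemma lip_wBV : lip0 (fun t => (w_B t)^-1).
Proof.
apply: lip0_inv; last by rewrite w_B0.
rewrite /w_B; have := lip_wb => lb; solve_lip0.
Qed.
Lemma lip_w : lip0 (fun t => W t).
Proof.
have lA := lip_wAV; have lB := lip_wBV.
by under eq_fun do rewrite wE; solve_lip0.
Qed.
Lemma lip_q : lip0 (fun t => q t).
Proof. rewrite /q; have lw := lip_w; solve_lip0. Qed.
Lemma lip_qV : lip0 (fun t => (q t)^-1).
Proof. exact: lip0_inv lip_q q0_neq0. Qed.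
Lemma lip_wV : lip0 (fun t => (W t)^-1).
Proof. exact: lip0_inv lip_w w0_neq0. Qed.

Lemma near_w : \forall t \near (0 : R)^'+, W t != 0.
Proof. exact: lip0_near_neq0 lip_w w0_neq0. Qed.

Lemma near_q : \forall t \near (0 : R)^'+, q t != 0.
Proof. exact: lip0_near_neq0 lip_q q0_neq0. Qed.

Lemma near_wd : \forall t \near (0 : R)^'+, w_d t != 0.
Proof. by apply: lip0_near_neq0 lip_wd _; rewrite w_d0. Qed.

Lemma near_wA : \forall t \near (0 : R)^'+, w_A t != 0.
Proof.
apply: lip0_near_neq0; last by rewrite w_A0.
by rewrite /w_A; have := lip_wa => la; solve_lip0.
Qed.

Lemma near_wB : \forall t \near (0 : R)^'+, w_B t != 0.
Proof.
apply: lip0_near_neq0; last by rewrite w_B0.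
by rewrite /w_B; have := lip_wb => lb; solve_lip0.
Qed.

(** The two differ only in denominators: [w_A] against [w_d], which is O(t^2) under a factor t^2,
    and [w_B] against c4, which is O(t) under a factor t^3. *)
Lemma w_sub_wa : orderO 4 (fun t => W t - w_a t).
Proof.
have lA := lip0_orderO0 _ lip_wAV; have ld := lip0_orderO0 _ lip_wdV.
have lB : orderO 1 (fun t => (w_B t)^-1 - c4^-1).
  by apply: lip0_orderO1_at lip_wBV _; rewrite w_B0.
apply: (@orderO_near _ _ _ (fun t => - (c2 * t ^+ 2 * (c4 * c2 * t ^+ 2 * (w_d t)^-1
    + c3 * t ^+ 3)) * (w_A t)^-1 * (w_d t)^-1
    + c3 * t ^+ 3 * ((w_B t)^-1 - c4^-1))); last solve_orderO.
apply: filterS3 near_wA near_wd near_wB => t.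
rewrite wE; move: (w_B t) => B' A0 d0 B0.
have -> : c4 * c2 * t ^+ 2 * (w_d t)^-1 + c3 * t ^+ 3 = w_A t - w_d t.
  rewrite /w_A /w_a [in RHS](_ : c4 * _ = w_d t - c5 * t + c4 * c2 * t ^+ 2 / w_d t
    + c3 * t ^+ 3); first by ring.
  by rewrite /w_d in d0 *; field; rewrite d0 hc4.
move: (w_A t) A0 => A A0; rewrite /w_a; move: (w_d t) d0 => d d0.
by field; rewrite A0 B0 d0 hc4.
Qed.

Lemma w_sub_wb : orderO 3 (fun t => W t - w_b t).
Proof.
have lB := lip0_orderO0 _ lip_wBV.
have lA : orderO 1 (fun t => (w_A t)^-1 - c4^-1).
  by apply: lip0_orderO1_at lip_wAV _; rewrite w_A0.
apply: (@orderO_near _ _ _ (fun t => c2 * t ^+ 2 * ((w_A t)^-1 - c4^-1)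
    + c3 * t ^+ 3 * (w_B t)^-1)); last solve_orderO.
by apply: nearW => t; rewrite wE /w_b; ring.
Qed.

(** [w] is a truncated iteration of this equation. Replacing [w_a] by [w] in the c2 term costs t^2
    t^4, and replacing [w_b] by [w] in the c3 term costs t^3 t^3. *)
Lemma w_fixpoint : orderO 6
  (fun t => W t - (1 - 2 * c1 * t + 2 * c2 * t ^+ 2 / q t + 2 * c3 * t ^+ 3 / (q t * W t))).
Proof.
have Ow := lip0_orderO0 _ lip_w; have OwV := lip0_orderO0 _ lip_wV.
have OqV := lip0_orderO0 _ lip_qV; have OAV := lip0_orderO0 _ lip_wAV.
have OBV := lip0_orderO0 _ lip_wBV; have Ob := lip0_orderO0 _ lip_wb.
have wa := w_sub_wa; have wb := w_sub_wb.
apply: (@orderO_near _ _ _ (fun t =>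
    c2 * t ^+ 2 * (2 * c4) * (W t - w_a t) * (w_A t)^-1 * (q t)^-1
    + c3 * t ^+ 3 * (2 * c4 * (W t + w_b t) + 2 * c5 * t) * (W t - w_b t)
      * (w_B t)^-1 * (q t)^-1 * (W t)^-1)); last solve_orderO.
apply: filterS2 (filterI near_wA near_wB) (filterI near_w near_q) => t [A0 B0] [w0' q0'].
rewrite {1}wE; move: A0 B0 w0' q0'; rewrite /= /q /w_A /w_B.
move: (W t) (w_a t) (w_b t) => w' a b A0 B0 w0' q0'.
by move: B0; rewrite mulf_eq0 negb_or => /andP[B0 b0]; field; rewrite A0 q0' w0' B0 b0.
Qed.

(** * The coefficients [g13], [g23] and the entry G_11 *)

Local Notation rho := (c5 / c4 * rr + b21 / (16 * c4 ^+ 6 * b11)).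
Local Notation kk := (2 * (2 * c5 ^+ 2 + 1)).

Lemma g13E t : gam t =
  t ^+ 2 * (q t)^-1 - kk * t ^+ 6 * (q t)^-1 ^+ 5 + rho * t ^+ 7.
Proof. by rewrite /g13 /g13t /r13 frob_norm_sqr -/(q t) exprVn [rho * _]mulrDl. Qed.

Lemma g23E t : del t =
  - ((t ^+ 2 * (q t)^-1 - kk * t ^+ 6 * (q t)^-1 ^+ 5) * (W t)^-1 * t)
  - 2 * c5 * t ^+ 6 * (q t)^-1 ^+ 4 * (W t)^-1 + rr * t ^+ 7.
Proof.
by rewrite /g23 /g13t /r23 -/(q t) !exprVn (invfM (q t ^+ 4)) (mulrA (_ * _) (_ ^-1)) addrA.
Qed.

Definition g11 t := 1 - 2 * c1 * t + 2 * c2 * gam t - 2 * c3 * del t.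

(** Up to O(t^6), [g13] is t^2 / q and [g23] is -t^3 / (q w), which turns G_11 into the right-hand
    side of the fixed-point equation of [w]. *)
Lemma g11_sub_w : orderO 6 (fun t => g11 t - W t).
Proof.
have OwV := lip0_orderO0 _ lip_wV; have OqV := lip0_orderO0 _ lip_qV.
have fw := w_fixpoint.
apply: (@orderO_near _ _ _ (fun t =>
    - (W t - (1 - 2 * c1 * t + 2 * c2 * t ^+ 2 / q t + 2 * c3 * t ^+ 3 / (q t * W t)))
    + 2 * c2 * (rho * t ^+ 7 - kk * t ^+ 6 * (q t)^-1 ^+ 5)
    - 2 * c3 * (kk * t ^+ 7 * (q t)^-1 ^+ 5 * (W t)^-1
       - 2 * c5 * t ^+ 6 * (q t)^-1 ^+ 4 * (W t)^-1 + rr * t ^+ 7))); last solve_orderO.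
apply: nearW => t; rewrite /g11 g13E g23E (invfM (q t)).
by move: rho rr (q t)^-1 (W t)^-1 (W t) => ? ? ? ? ?; ring.
Qed.

Lemma lip_g13 : lip0 (fun t => gam t).
Proof.
have lq := lip_qV.
by under eq_fun do rewrite g13E; solve_lip0.
Qed.

Lemma lip_g23 : lip0 (fun t => del t).
Proof.
have lq := lip_qV; have lw := lip_wV.
by under eq_fun do rewrite g23E; solve_lip0.
Qed.

Lemma g11_0 : g11 0 = 1.
Proof. by rewrite /g11 g13E g23E !expr0n /= !(mulr0, mul0r, subr0, addr0, oppr0). Qed.

Lemma lip_g11 : lip0 (fun t => g11 t).
Proof. rewrite /g11; have l13 := lip_g13; have l23 := lip_g23; solve_lip0. Qed.

Lemma lip_g11V : lip0 (fun t => (g11 t)^-1).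
Proof. by apply: lip0_inv lip_g11 _; rewrite g11_0 oner_neq0. Qed.

Lemma near_g11 : \forall t \near (0 : R)^'+, 0 < g11 t.
Proof.
apply: (@orderO_near_ge _ 1 0) => //; have h := lip0_orderO1_at _ _ lip_g11 g11_0.
by under eq_fun do rewrite expr0 mulr1.
Qed.

(** * The vector p, the lower right block of N and its positivity *)

Local Notation beta := (b21 / (8 * c4 ^+ 5 * b11)).
(* p = (g11, tau, sigma), and M22, M23, M33 are the lower right entries of N;
   they are chosen so that P - N agrees exactly with G in these entries.  The
   corrections of order t^7 and t^6 in tau and sigma absorb N_12 and N_13. *)
Definition mu := (8 * c4 ^+ 4)^-1.
Definition tau t := t - mu * t ^+ 7.
Definition sigma t := - gam t + t ^+ 6 * (q t)^-1 ^+ 3 * (W t)^-1 ^+ 2 - c5 * mu * t ^+ 7.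
Definition M22 t := tau t ^+ 2 * (g11 t)^-1 - (2 * c4 * gam t - 2 * c5 * del t).
Definition M23 t := tau t * sigma t * (g11 t)^-1 - del t.
Definition M33 t := sigma t ^+ 2 * (g11 t)^-1.

Lemma b11_neq0 : b11 != 0.
Proof.
have -> : b11 = 4 * c1 ^+ 2 + 2.
  by rewrite inner_prodE !big_ord_recl !big_ord0 !mxE /=; ring.
by rewrite lt0r_neq0 // ltr_wpDl // mulr_ge0 // sqr_ge0.
Qed.

Let near_wqx : \forall t \near (0 : R)^'+, [/\ W t != 0, q t != 0 & g11 t != 0].
Proof.
apply: filterS3 near_w near_q near_g11 => t w0' q0' x0.
by split=> //; exact: lt0r_neq0.
Qed.

Let OwV := lip0_orderO0 _ lip_wV.
Let Ow := lip0_orderO0 _ lip_w.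
Let OqV := lip0_orderO0 _ lip_qV.
Let OxV := lip0_orderO0 _ lip_g11V.
Let Ox := lip0_orderO0 _ lip_g11.
Let Oxw := g11_sub_w.

Lemma g13_err : orderO 6 (fun t => gam t - t ^+ 2 * (q t)^-1).
Proof.
apply: (@orderO_near _ _ _ (fun t => - (kk * t ^+ 6 * (q t)^-1 ^+ 5) + rho * t ^+ 7)).
  by apply: nearW => t; rewrite g13E; ring.
have := OqV => Oq; solve_orderO.
Qed.

Lemma sigma_err : orderO 6 (fun t => sigma t + t ^+ 2 * (q t)^-1).
Proof.
have Og := g13_err; have Oq := OqV; have Ow' := OwV.
apply: (@orderO_near _ _ _ (fun t => - (gam t - t ^+ 2 * (q t)^-1)
  + t ^+ 6 * (q t)^-1 ^+ 3 * (W t)^-1 ^+ 2 - c5 * mu * t ^+ 7)).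
  by apply: nearW => t; rewrite /sigma; ring.
solve_orderO.
Qed.

Lemma sigma_ord : orderO 2 (fun t => sigma t).
Proof.
have Og := sigma_err; have Oq := OqV.
apply: (@orderO_near _ _ _ (fun t => (sigma t + t ^+ 2 * (q t)^-1) - t ^+ 2 * (q t)^-1)).
  by apply: nearW => t; ring.
solve_orderO.
Qed.

Lemma tau_ord : orderO 1 (fun t => tau t).
Proof. rewrite /tau; solve_orderO. Qed.

(** Replacing tau^2 / g11 by t^2 / w costs O(t^8). By the definition of q, the part [g13t]
    contributes [g13t] q / w, whose main term cancels t^2 / w; its correction and the t^6 term of
    [r23] leave 2 (2 c5^2 + 1) - 4 c5^2 = 2 as coefficient. In the t^7 terms [r0] cancels, and the
    second term of [r13] gives beta. *)
Lemma M22_exp :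
  orderO 8 (fun t => M22 t - (2 * t ^+ 6 * (q t)^-1 ^+ 4 * (W t)^-1 - beta * t ^+ 7)).
Proof.
have := (OwV, OqV, OxV, Oxw) => -[[[h1 h2] h3] h4].
apply: (@orderO_near _ _ _ (fun t => t ^+ 8 * (mu ^+ 2 * t ^+ 6 - 2 * mu) * (g11 t)^-1
  - t ^+ 2 * (g11 t - W t) * (g11 t)^-1 * (W t)^-1)); last solve_orderO.
apply: filterS near_wqx => t [w0' q0' x0].
rewrite /M22 /tau g13E g23E.
move: (g11 t) x0 q0' => x x0; rewrite /q.
move: (W t) w0' rr mu b11 b11_neq0 => w' w0' r mu' b b0 q0'.
by field; rewrite w0' x0 q0' hc4 b0.
Qed.

Lemma muE : 2 * (q 0)^-1 ^+ 4 * (W 0)^-1 = mu.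
Proof. by rewrite q0 w0 /mu; field; exact: hc4. Qed.

Let Omu : orderO 1 (fun t => 2 * (q t)^-1 ^+ 4 * (W t)^-1 - mu).
Proof.
have lw := lip_wV; have lq := lip_qV.
by apply: lip0_orderO1_at muE; solve_lip0.
Qed.

Let OxV1 : orderO 1 (fun t => (g11 t)^-1 - 1).
Proof. by apply: lip0_orderO1_at lip_g11V _; rewrite g11_0 invr1. Qed.

Lemma M22_lead : orderO 7 (fun t => M22 t - mu * t ^+ 6).
Proof.
have h := M22_exp; have h1 := Omu.
apply: (@orderO_near _ _ _ (fun t =>
  (M22 t - (2 * t ^+ 6 * (q t)^-1 ^+ 4 * (W t)^-1 - beta * t ^+ 7))
  + t ^+ 6 * (2 * (q t)^-1 ^+ 4 * (W t)^-1 - mu) - beta * t ^+ 7)); last solve_orderO.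
by apply: nearW => t; ring.
Qed.

Lemma M22_ord : orderO 6 (fun t => M22 t).
Proof.
have h := M22_lead.
apply: (@orderO_near _ _ _ (fun t => (M22 t - mu * t ^+ 6) + mu * t ^+ 6)); last solve_orderO.
by apply: nearW => t; ring.
Qed.

(** The t^6 term of [r23] makes the main term of [M23] c5 times that of [M22], as the pairing with
    [B3] requires. The last summand stems from the t^6 term of [sigma]. *)
Lemma M23_exp :
  orderO 8 (fun t => M23 t - (2 * c5 * t ^+ 6 * (q t)^-1 ^+ 4 * (W t)^-1 - rr * t ^+ 7
    + t ^+ 7 * (q t)^-1 ^+ 3 * (W t)^-1 ^+ 3)).
Proof.
have := (OwV, OqV, OxV, Oxw, sigma_ord) => -[[[[h1 h2] h3] h4] h5].
apply: (@orderO_near _ _ _ (fun t =>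
   sigma t * (- (mu * t ^+ 7) * (g11 t)^-1 - t * (g11 t - W t) * (g11 t)^-1 * (W t)^-1)
   - c5 * mu * t ^+ 8 * (W t)^-1 - rho * t ^+ 8 * (W t)^-1)); last solve_orderO.
apply: filterS near_wqx => t [w0' q0' x0].
rewrite /M23 /tau /sigma g13E g23E.
move: (g11 t) x0 q0' => x x0; move: (q t) (W t) w0' rr mu b11 b11_neq0.
move=> q' w' w0' r mu' b b0 q0'.
by field; rewrite w0' x0 q0' hc4 b0.
Qed.

Lemma M23_lead : orderO 7 (fun t => M23 t - c5 * mu * t ^+ 6).
Proof.
have h := M23_exp; have h1 := Omu; have := (OwV, OqV) => -[h2 h3].
apply: (@orderO_near _ _ _ (fun t =>
  (M23 t - (2 * c5 * t ^+ 6 * (q t)^-1 ^+ 4 * (W t)^-1 - rr * t ^+ 7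
    + t ^+ 7 * (q t)^-1 ^+ 3 * (W t)^-1 ^+ 3))
  + c5 * t ^+ 6 * (2 * (q t)^-1 ^+ 4 * (W t)^-1 - mu) - rr * t ^+ 7
  + t ^+ 7 * (q t)^-1 ^+ 3 * (W t)^-1 ^+ 3)); last solve_orderO.
by apply: nearW => t; ring.
Qed.

Lemma M23_ord : orderO 6 (fun t => M23 t).
Proof.
have h := M23_lead.
apply: (@orderO_near _ _ _ (fun t => (M23 t - c5 * mu * t ^+ 6) + c5 * mu * t ^+ 6)).
  by apply: nearW => t; ring.
solve_orderO.
Qed.

Lemma M33_lead : orderO 5 (fun t => M33 t - (4 * c4 ^+ 2)^-1 * t ^+ 4).
Proof.
have := (OqV, OxV, OxV1, sigma_err, sigma_ord) => -[[[[h1 h2] h3] h4] h5].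
have h6 : orderO 1 (fun t => (q t)^-1 ^+ 2 - (4 * c4 ^+ 2)^-1).
  have lq := lip_qV; apply: (@lip0_orderO1_at _ (fun t => (q t)^-1 ^+ 2)); first solve_lip0.
  by rewrite q0; field; exact: hc4.
apply: (@orderO_near _ _ _ (fun t =>
  (sigma t + t ^+ 2 * (q t)^-1) * (sigma t - t ^+ 2 * (q t)^-1) * (g11 t)^-1
  + t ^+ 4 * (q t)^-1 ^+ 2 * ((g11 t)^-1 - 1)
  + t ^+ 4 * ((q t)^-1 ^+ 2 - (4 * c4 ^+ 2)^-1))); last solve_orderO.
by apply: nearW => t; rewrite /M33; ring.
Qed.

Lemma M33_ord : orderO 4 (fun t => M33 t).
Proof. rewrite /M33; have := (OxV, sigma_ord) => -[h1 h2]; solve_orderO. Qed.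

Lemma near_M33_gt0 : \forall t \near (0 : R)^'+, 0 < M33 t.
Proof.
apply: orderO_near_ge M33_lead.
by rewrite invr_gt0 mulr_gt0 // exprn_even_gt0.
Qed.

(** M22 M33 has a positive leading term of order 6 + 4 = 10, while M23^2 is O(t^12). *)
Lemma near_M_det : \forall t \near (0 : R)^'+, M23 t ^+ 2 <= M22 t * M33 t.
Proof.
have := (M22_lead, M22_ord, M33_lead, M33_ord, M23_ord) => -[[[[h1 h2] h3] h4] h5].
have a0 : 0 < mu * (4 * c4 ^+ 2)^-1.
  by rewrite mulr_gt0 // invr_gt0 mulr_gt0 // exprn_even_gt0.
apply: filterS (@orderO_near_ge _ _ 10 (fun t => M22 t * M33 t - M23 t ^+ 2) a0 _).
  by move=> t /ltW; rewrite subr_ge0.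
apply: (@orderO_near _ _ _ (fun t => (M22 t - mu * t ^+ 6) * M33 t
   + mu * t ^+ 6 * (M33 t - (4 * c4 ^+ 2)^-1 * t ^+ 4) - M23 t ^+ 2)); last solve_orderO.
by apply: nearW => t; ring.
Qed.

(** * Discrepancy between G and P - N in the first row *)

Lemma residual11 : orderO 8 (fun t => M22 t * (tau t * (g11 t)^-1) ^+ 2
  + 2 * M23 t * (tau t * (g11 t)^-1) * (sigma t * (g11 t)^-1)
  + M33 t * (sigma t * (g11 t)^-1) ^+ 2).
Proof.
have := (M22_ord, M33_ord, M23_ord, tau_ord, sigma_ord, OxV).
move=> -[[[[[h1 h2] h3] h4] h5] h6]; solve_orderO.
Qed.

Lemma residual12 : orderO 8 (fun t =>
  tau t + (tau t * M22 t + sigma t * M23 t) * (g11 t)^-1 - t).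
Proof.
have := (M22_lead, M22_ord, M23_ord, sigma_ord, OxV, OxV1).
move=> -[[[[[h1 h2] h3] h4] h5] h6].
apply: (@orderO_near _ _ _ (fun t => t * (M22 t - mu * t ^+ 6) * (g11 t)^-1
  + mu * t ^+ 7 * ((g11 t)^-1 - 1) - mu * t ^+ 7 * M22 t * (g11 t)^-1
  + sigma t * M23 t * (g11 t)^-1)); last solve_orderO.
by apply: nearW => t; rewrite /tau; ring.
Qed.

(** Since sigma is -t^2 / q up to O(t^6), the term sigma M33 / g11 = sigma^3 / g11^2 is -t^6 / (q^3
    w^2) up to O(t^8); tau M23 / g11 is c5 mu t^7. The corrections in [sigma] are the negatives of
    these two. *)
Lemma residual13 : orderO 8 (fun t =>
  sigma t + (tau t * M23 t + sigma t * M33 t) * (g11 t)^-1 + gam t).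
Proof.
have := (M23_lead, M23_ord, sigma_ord, sigma_err, OxV, OxV1, OqV, OwV).
move=> -[[[[[[[h1 h2] h3] h4] h5] h6] h7] h8].
have := (Oxw, Ow, Ox) => -[[h9 h10] h11].
apply: (@orderO_near _ _ _ (fun t => t * (M23 t - c5 * mu * t ^+ 6) * (g11 t)^-1
  + c5 * mu * t ^+ 7 * ((g11 t)^-1 - 1) - mu * t ^+ 7 * M23 t * (g11 t)^-1
  + (sigma t + t ^+ 2 * (q t)^-1) * (sigma t ^+ 2 - sigma t * (t ^+ 2 * (q t)^-1)
      + (t ^+ 2 * (q t)^-1) ^+ 2) * (g11 t)^-1 ^+ 2
  + t ^+ 6 * (q t)^-1 ^+ 3 * ((g11 t - W t) * (g11 t + W t) * (g11 t)^-1 ^+ 2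
      * (W t)^-1 ^+ 2))); last solve_orderO.
apply: filterS near_wqx => t [w0' q0' x0].
rewrite /M33 {1}/sigma /tau.
move: (sigma t) (M23 t) (gam t) (g11 t) x0 (q t) (W t) w0' mu q0'.
move=> s m g x x0 q' w' w0' mu' q0'.
by field; rewrite w0' x0 q0'.
Qed.

(** * Cancellation in the pairings with [B2] and [B3] *)

Local Notation kappa := (4 * c4 ^+ 4 * b11)^-1.

(** The t^7 term of [M22] is tuned by 2 c4 beta = kappa b21. The t^6 terms of [M22] and [sigma]
    combine through q = 2 c4 w + 2 c5 t into a t^7 term, cancelled by c5 mu t^7 in [sigma]. *)
Lemma pairing_B2 : orderO 8 (fun t =>
  2 * c4 * M22 t - 2 * (sigma t + gam t) + kappa * t ^+ 7 * b21).
Proof.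
have := (M22_exp, OwV, OqV) => -[[h1 h2] h3].
have h4 : orderO 1 (fun t => 4 * (q t)^-1 ^+ 4 * (W t)^-1 ^+ 2 - 2 * mu).
  have lw := lip_wV; have lq := lip_qV.
  apply: (@lip0_orderO1_at _ (fun t => 4 * (q t)^-1 ^+ 4 * (W t)^-1 ^+ 2)).
    by solve_lip0.
  by rewrite q0 w0 /mu; field; exact: hc4.
apply: (@orderO_near _ _ _ (fun t =>
  2 * c4 * (M22 t - (2 * t ^+ 6 * (q t)^-1 ^+ 4 * (W t)^-1 - beta * t ^+ 7))
  - c5 * t ^+ 7 * (4 * (q t)^-1 ^+ 4 * (W t)^-1 ^+ 2 - 2 * mu))); last solve_orderO.
apply: filterS near_wqx => t [w0' q0' _]; rewrite /sigma.
move: (M22 t) (gam t) q0' mu => m g; rewrite /q.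
move: (W t) w0' b11 b11_neq0 => w' w0' b b0 q0' mu'.
by field; rewrite w0' q0' hc4 b0.
Qed.

(** The t^6 terms cancel identically, and [r0] is the value for which the t^7 coefficient 2 c5 beta
    - 2 r0 + 1 / (4 c4^3) + kappa b31 vanishes. *)
Lemma pairing_B3 : orderO 8 (fun t =>
  - (2 * c5) * M22 t + 2 * M23 t + kappa * t ^+ 7 * b31).
Proof.
have := (M22_exp, M23_exp) => -[h1 h2].
have h4 : orderO 1 (fun t => (q t)^-1 ^+ 3 * (W t)^-1 ^+ 3 - (8 * c4 ^+ 3)^-1).
  have lw := lip_wV; have lq := lip_qV.
  apply: (@lip0_orderO1_at _ (fun t => (q t)^-1 ^+ 3 * (W t)^-1 ^+ 3)).
    by solve_lip0.
  by rewrite q0 w0; field; exact: hc4.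
apply: (@orderO_near _ _ _ (fun t =>
  - (2 * c5) * (M22 t - (2 * t ^+ 6 * (q t)^-1 ^+ 4 * (W t)^-1 - beta * t ^+ 7))
  + 2 * (M23 t - (2 * c5 * t ^+ 6 * (q t)^-1 ^+ 4 * (W t)^-1 - rr * t ^+ 7
    + t ^+ 7 * (q t)^-1 ^+ 3 * (W t)^-1 ^+ 3))
  + 2 * t ^+ 7 * ((q t)^-1 ^+ 3 * (W t)^-1 ^+ 3 - (8 * c4 ^+ 3)^-1))); last solve_orderO.
apply: nearW => t; rewrite /r0 frob_norm_sqr.
move: (M22 t) (M23 t) (q t)^-1 (W t)^-1 b11 b11_neq0 => m n q' w' b b0.
by field; rewrite hc4 b0.
Qed.

(** * Effect of the shifted argument on [g13] and [g23] *)

Let Oh : orderO 7 (fun t => kappa * t ^+ 7).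
Proof. solve_orderO. Qed.

Lemma g13_shift : orderO 8 (fun t => gam (t - kappa * t ^+ 7) - gam t).
Proof.
have lq := lip_qV.
have l : lip0 (fun t => (q t)^-1 - kk * t ^+ 4 * (q t)^-1 ^+ 5 + rho * t ^+ 5) by solve_lip0.
apply: orderO_near (orderO_shift _ _ l Oh).
by apply: nearW => t; rewrite !g13E /=; ring.
Qed.

Lemma g23_shift : orderO 8 (fun t => del (t - kappa * t ^+ 7) - del t).
Proof.
have lq := lip_qV; have lw := lip_wV.
have l : lip0 (fun t => - (((q t)^-1 - kk * t ^+ 4 * (q t)^-1 ^+ 5) * (W t)^-1 * t)
  - 2 * c5 * t ^+ 4 * (q t)^-1 ^+ 4 * (W t)^-1 + rr * t ^+ 5) by solve_lip0.
apply: orderO_near (orderO_shift _ _ l Oh).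
by apply: nearW => t; rewrite !g23E /=; ring.
Qed.

(** * The two projections of G *)

Local Notation y t := (tau t * (g11 t)^-1).
Local Notation z t := (sigma t * (g11 t)^-1).
Local Notation Gt := (G c1 c2 c3 c4 c5).
Definition Pt t := (g11 t)^-1 *: (col3 (g11 t) (tau t) (sigma t)
  *m (col3 (g11 t) (tau t) (sigma t))^T).
Definition Nt t := Nmx (y t) (z t) (M22 t) (M23 t) (M33 t).
(** Only the [B1] coordinate of [G t] is shifted. By [g13_shift] and [g23_shift] this point of E
    differs from G(t - kappa t^7) by O(t^8). *)
Definition Yt t := Ustar R + (t - kappa * t ^+ 7) *: B1 c1 + gam t *: B2 c2 c4
  + del t *: B3 c3 c5.
Local Notation psdG t := (proj_on (psd_cone R 3) (Gt t)).

Lemma GE t : Gt t = mx3 [:: [:: g11 t; t; - gam t];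
  [:: t; 2 * c4 * gam t - 2 * c5 * del t; del t]; [:: - gam t; del t; 0]].
Proof.
rewrite /G /g11; move: (gam t) (del t) => g d.
apply/matrixP => -[[|[|[|//]]] i3] -[[|[|[|//]]] j3]; rewrite !mxE /=; ring.
Qed.

Lemma PtE t : g11 t != 0 -> Pt t = mx3 [:: [:: g11 t; tau t; sigma t];
  [:: tau t; tau t ^+ 2 * (g11 t)^-1; tau t * sigma t * (g11 t)^-1];
  [:: sigma t; tau t * sigma t * (g11 t)^-1; sigma t ^+ 2 * (g11 t)^-1]].
Proof.
rewrite /Pt; move: (g11 t) (tau t) (sigma t) => x a b x0.
by apply/matrixP => -[[|[|[|//]]] i3] -[[|[|[|//]]] j3];
  rewrite !mxE !big_ord_recl !big_ord0 !mxE /=; field.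
Qed.

Lemma G_decomposition i j : orderO 8 (fun t => (Gt t - (Pt t - Nt t)) i j).
Proof.
have := (residual11, residual12, residual13) => -[[h1 h2] h3].
pose e11 t := N11 (y t) (z t) (M22 t) (M23 t) (M33 t).
pose e12 t := - (tau t + (tau t * M22 t + sigma t * M23 t) * (g11 t)^-1 - t).
pose e13 t := - (sigma t + (tau t * M23 t + sigma t * M33 t) * (g11 t)^-1 + gam t).
apply: (@orderO_near _ _ _ (fun t => mx3 [:: [:: e11 t; e12 t; e13 t];
   [:: e12 t; 0; 0]; [:: e13 t; 0; 0]] i j)).
  apply: filterS near_wqx => t [_ _ x0]; rewrite GE PtE // /Nt NmxE.
  rewrite /e11 /e12 /e13 !mxE.
  case: i j => [[|[|[|//]]] i3] -[[|[|[|//]]] j3] /=; try by ring.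
  - by rewrite /M22; ring.
  - by rewrite /M23; ring.
  - by rewrite /M23; ring.
  - by rewrite /M33; ring.
have O0 : orderO 8 (fun=> 0 : R) by exists 0; apply: nearW => t; rewrite normr0 mul0r.
have O12 : orderO 8 e12 by rewrite /e12; solve_orderO.
have O13 : orderO 8 e13 by rewrite /e13; solve_orderO.
have O11 : orderO 8 e11 by exact: h1.
under eq_fun do rewrite mxE.
by case: i j => [[|[|[|//]]] i3] -[[|[|[|//]]] j3].
Qed.

Lemma psd_proj_G i j : orderO 8 (fun t => (psdG t - Pt t) i j).
Proof.
apply: orderO_frobenius G_decomposition i j.
apply: filterS3 near_M33_gt0 near_M_det near_g11 => t m0 dm x0.
apply: psd_proj_stable.
- by apply: psd_cone_rank1; rewrite invr_ge0 ltW.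
- rewrite /Pt inner_prodZr.
  have -> : tau t = g11 t * y t by rewrite mulrCA divff ?mulr1 ?lt0r_neq0.
  have -> : sigma t = g11 t * z t by rewrite mulrCA divff ?mulr1 ?lt0r_neq0.
  by rewrite Nmx_orth mulr0.
- by move=> Z; apply: quad_comb_dual.
Qed.

Lemma Nt_pairing :
  [/\ orderO 8 (fun t => inner_prod (Nt t + (kappa * t ^+ 7) *: B1 c1) (B1 c1)),
      orderO 8 (fun t => inner_prod (Nt t + (kappa * t ^+ 7) *: B1 c1) (B2 c2 c4))
    & orderO 8 (fun t => inner_prod (Nt t + (kappa * t ^+ 7) *: B1 c1) (B3 c3 c5))].
Proof.
have O12 := residual12; have O13 := residual13.
have O11 : orderO 8 (fun t => N11 (y t) (z t) (M22 t) (M23 t) (M33 t)) := residual11.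
have O2 := pairing_B2; have O3 := pairing_B3.
split.
(* N_12 is -mu t^7 up to O(t^8) and occurs twice in the pairing; kappa b11 = 2 mu cancels it. *)
- apply: (@orderO_near _ _ _ (fun t =>
    - (2 * c1) * N11 (y t) (z t) (M22 t) (M23 t) (M33 t)
    - 2 * (tau t + (tau t * M22 t + sigma t * M23 t) * (g11 t)^-1 - t))); last solve_orderO.
  apply: nearW => t; rewrite inner_prodDl inner_prodZl inner_Nmx_B1.
  move: (N11 (y t) (z t) (M22 t) (M23 t) (M33 t)) => n.
  move: (g11 t)^-1 (sigma t) (M22 t) (M23 t) b11 b11_neq0.
  by rewrite /tau /mu => x s m22 m23 b b0; field; rewrite hc4 b0.
- apply: (@orderO_near _ _ _ (fun t =>
    2 * c2 * N11 (y t) (z t) (M22 t) (M23 t) (M33 t)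
    + (2 * c4 * M22 t - 2 * (sigma t + gam t) + kappa * t ^+ 7 * b21)
    + 2 * (sigma t + (tau t * M23 t + sigma t * M33 t) * (g11 t)^-1 + gam t)));
    last solve_orderO.
  apply: nearW => t; rewrite inner_prodDl inner_prodZl inner_Nmx_B2.
  by rewrite (inner_prodC (B1 c1)); ring.
- apply: (@orderO_near _ _ _ (fun t =>
    - (2 * c3) * N11 (y t) (z t) (M22 t) (M23 t) (M33 t)
    + (- (2 * c5) * M22 t + 2 * M23 t + kappa * t ^+ 7 * b31))); last solve_orderO.
  apply: nearW => t; rewrite inner_prodDl inner_prodZl inner_Nmx_B3.
  by rewrite (inner_prodC (B1 c1)); ring.
Qed.

(** [psdG t - Yt t] is [Nt t + kappa t^7 B1] up to O(t^8). It is not itself of order 8, because of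
    the entry [M33]; only its pairings with suitable [B] are. *)
Lemma psd_proj_pairing (B : 'M[R]_3) :
    orderO 8 (fun t => inner_prod (Nt t + (kappa * t ^+ 7) *: B1 c1) B) ->
  orderO 8 (fun t => inner_prod (psdG t - Yt t) B).
Proof.
move=> ON; have OB i j : orderO 0 (fun=> B i j) := orderO_cst (B i j).
have h1 := orderO_inner_prod _ _ _ _ _ psd_proj_G OB.
have h2 := orderO_inner_prod _ _ _ _ _ G_decomposition OB.
rewrite /= in h1 h2.
apply: (@orderO_near _ _ _ (fun t => inner_prod (psdG t - Pt t) B
  - inner_prod (Gt t - (Pt t - Nt t)) B
  + inner_prod (Nt t + (kappa * t ^+ 7) *: B1 c1) B)); last solve_orderO.
apply: nearW => t; rewrite -inner_prodNl -!inner_prodDl; congr inner_prod.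
by rewrite /Yt /G; apply/matrixP => i j; rewrite !mxE; ring.
Qed.

Lemma E_proj_G i j : orderO 8 (fun t => (proj_on (E c1 c2 c3 c4 c5) (psdG t) - Yt t) i j).
Proof.
have [/psd_proj_pairing h1 /psd_proj_pairing h2 /psd_proj_pairing h3] := Nt_pairing.
apply: (@orderO_sqr _ 8 _ (fun t => 3 * (inner_prod (psdG t - Yt t) (B1 c1) ^+ 2
    + inner_prod (psdG t - Yt t) (B2 c2 c4) ^+ 2
    + inner_prod (psdG t - Yt t) (B3 c3 c5) ^+ 2))); last solve_orderO.
apply: nearW => t; apply: le_trans (sqr_entry_le _ i j) (E_proj_dist _ _ _ _ _ _ _ _).
by exists (t - kappa * t ^+ 7), (gam t), (del t).
Qed.

End Expansion.
Theorem theorem6p3 (R : realType) (c1 c2 c3 c4 c5 : R) (hc4 : c4 != 0)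
    (i j : 'I_3) :
  (fun t : R =>
     proj_on (E c1 c2 c3 c4 c5) (proj_on (psd_cone R 3) (G c1 c2 c3 c4 c5 t)) i j)
  = (fun t : R =>
       G c1 c2 c3 c4 c5
         (t - t ^+ 7 / (4 * c4 ^+ 4 * frob_norm (B1 c1) ^+ 2)) i j)
    +O_ (0^'+) (fun t : R => t ^+ 8).
Proof.
have h1 := E_proj_G c1 c2 c3 c4 c5 hc4 i j.
have h2 := g13_shift c1 c2 c3 c4 c5 hc4; have h3 := g23_shift c1 c2 c3 c4 c5 hc4.
apply/eqaddOP/bigO_exP.
suff [K hK] : orderO 8 (fun t => proj_on (E c1 c2 c3 c4 c5)
    (proj_on (psd_cone R 3) (G c1 c2 c3 c4 c5 t)) i j
    - G c1 c2 c3 c4 c5 (t - t ^+ 7 / (4 * c4 ^+ 4 * frob_norm (B1 c1) ^+ 2)) i j).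
  (* The library form of O asks for a positive constant, whereas [orderO] leaves the sign of [K]
     open. *)
  exists (`|K| + 1); first by rewrite ltr_wpDl.
  apply: filterS2 near_gt0 hK => t t0 /le_trans; apply => /=.
  have t8 : 0 < t ^+ 8 by rewrite exprn_gt0.
  by rewrite (gtr0_norm t8) ler_pM2r // (le_trans (ler_norm K)) ?lerDl.
(* The [B1] coordinates of [Yt] and of the shifted G coincide, so only the changes of [g13] and
   [g23] under the shift remain. *)
apply: (@orderO_near _ _ _ (fun t =>
  (proj_on (E c1 c2 c3 c4 c5) (proj_on (psd_cone R 3) (G c1 c2 c3 c4 c5 t))
    - Yt c1 c2 c3 c4 c5 t) i j
  - (g13 c1 c2 c3 c4 c5 (t - (4 * c4 ^+ 4 * inner_prod (B1 c1) (B1 c1))^-1 * t ^+ 7)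
      - g13 c1 c2 c3 c4 c5 t) * B2 c2 c4 i j
  - (g23 c1 c2 c3 c4 c5 (t - (4 * c4 ^+ 4 * inner_prod (B1 c1) (B1 c1))^-1 * t ^+ 7)
      - g23 c1 c2 c3 c4 c5 t) * B3 c3 c5 i j)); last solve_orderO.
apply: nearW => t; rewrite frob_norm_sqr (mulrC (t ^+ 7)) /Yt.
by move: (t - _ * t ^+ 7) => s; rewrite /G !mxE; ring.
Qed.
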